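(* Let $\Theta$ be a variety of (one-sorted) algebras such that $\Phi(F(x_1))\cong F(x_1)$ for every automorphism $\Phi$ of the category $\Theta^0$. Let $H_1,H_2\in\Theta$. Then the following two conditions are equivalent. (New) There exist isomorphisms of categories $\Lambda:\mathfrak{Cl}_{H_1}\to\mathfrak{Cl}_{H_2}$, $\Phi:\Theta^0\to\Theta^0$, $\Psi:\mathfrak{Cor}_{H_1}\to\mathfrak{Cor}_{H_2}$ such that $\mathcal{FG}_{H_2}\Lambda=\Phi\,\mathcal{FG}_{H_1}$ and $\mathcal{FR}_{H_2}\Lambda=\Psi\,\mathcal{FR}_{H_1}$. (Old) There exist an automorphism $\Phi:\Theta^0\to\Theta^0$ and, for every $F(X)\in\mathrm{Ob}\,\Theta^0$, a bijection $\alpha(\Phi)_{F(X)}:Cl_{H_1}(F(X))\to Cl_{H_2}(\Phi(F(X)))$, such that for all $F(X_1),F(X_2)\in\mathrm{Ob}\,\Theta^0$, all $\mu_1,\mu_2\in\mathrm{Hom}(F(X_1),F(X_2))$ and all $T\in Cl_{H_1}(F(X_2))$: $$\tau\mu_1=\tau\mu_2\quad\text{if and only if}\quad\widetilde\tau\,\Phi(\mu_1)=\widetilde\tau\,\Phi(\mu_2),$$ where $\tau:F(X_2)\to F(X_2)/T$ and $\widetilde\tau:\Phi(F(X_2))\to\Phi(F(X_2))/\alpha(\Phi)_{F(X_2)}(T)$ are the natural epimorphisms.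
   Context: $X_0$ is a fixed infinite countable set; for finite $X\subset X_0$, $F(X)$ is the free algebra of $\Theta$ with the set $X$ of free generators; $F(x_1)$ is the free algebra on the one-element set $\{x_1\}$, $x_1\in X_0$. $\Theta^0$ is the category whose objects are the algebras $F(X)$, $X\subset X_0$ finite, and whose morphisms are all homomorphisms. An automorphism of $\Theta^0$ is an isomorphism of categories $\Theta^0\to\Theta^0$. For $H\in\Theta$ and $T\subseteq F(X)\times F(X)$, put $T''_H=\bigcap\{\ker\varphi\mid \varphi\in\mathrm{Hom}(F(X),H),\ T\subseteq\ker\varphi\}\subseteq F(X)\times F(X)$, where $\ker\varphi=\{(a,b)\mid\varphi(a)=\varphi(b)\}$. $T$ is $H$-closed if $T=T''_H$ (then it is a congruence). $Cl_H(F(X))$ is the family of all $H$-closed $T\subseteq F(X)\times F(X)$. For a map $\varphi$ and a set $T$ of pairs, $\varphi(T)=\{(\varphi(a),\varphi(b))\mid(a,b)\in T\}$. $\mathfrak{Cl}_H$: objects are pairs $(F(X),T)$ with $F(X)\in\mathrm{Ob}\,\Theta^0$, $T\in Cl_H(F(X))$; morphisms $(F(X_1),T_1)\to(F(X_2),T_2)$ are homomorphisms $\varphi:F(X_1)\to F(X_2)$ with $\varphi(T_1)\subseteq T_2$; composition is composition of homomorphisms. $\mathfrak{Cor}_H$: objects are the quotient algebras $F(X)/T$ (whose elements are the $T$-congruence classes) with $F(X)\in\mathrm{Ob}\,\Theta^0$, $T\in Cl_H(F(X))$; morphisms are all homomorphisms. Functor $\mathcal{FR}_H:\mathfrak{Cl}_H\to\mathfrak{Cor}_H$: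 $\mathcal{FR}_H(F(X),T)=F(X)/T$, and for a morphism $\mu:(F(X_1),T_1)\to(F(X_2),T_2)$, $\mathcal{FR}_H(\mu)$ is the unique homomorphism $\varphi:F(X_1)/T_1\to F(X_2)/T_2$ with $\varphi\tau_1=\tau_2\mu$, where $\tau_i:F(X_i)\to F(X_i)/T_i$ are the natural epimorphisms. Functor $\mathcal{FG}_H:\mathfrak{Cl}_H\to\Theta^0$: $\mathcal{FG}_H(F(X),T)=F(X)$ and $\mathcal{FG}_H(\varphi)=\varphi$. *)

(* Defs.v *)
From mathcomp Require Import all_boot finmap.
From mathcomp Require Import boolp classical_sets functions cardinality.

Set Implicit Arguments.
Unset Strict Implicit.
Unset Printing Implicit Defensive.

Local Open Scope classical_set_scope.

Record signature := Signature { symbol : Type; arity : symbol -> nat }.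

(* Carriers may be empty, so that F(X) exists for every finite X, including
   X = set0 when there are no constants. *)
Record algebra (S : signature) := Algebra {
  carrier :> Type;
  op : forall o : symbol S, ('I_(arity o) -> carrier) -> carrier }.
Arguments op {S a} o _.

Definition is_hom (S : signature) (A B : algebra S) (f : A -> B) : Prop :=
  forall (o : symbol S) (a : 'I_(arity o) -> A),
    f (op o a) = op o (fun i => f (a i)).

Record hom (S : signature) (A B : algebra S) := Hom {
  hom_fun :> A -> B;
  hom_fun_is_hom : is_hom hom_fun }.

Lemma hom_eq (S : signature) (A B : algebra S) (f g : hom A B) :
  (forall a, f a = g a) -> f = g.
Proof.
case: f g => [f hf] [g hg] /= /funext e.
by move: hf hg; rewrite e => hf hg; congr Hom; exact: Prop_irrelevance.
Qed.

Definition hom_id (S : signature) (A : algebra S) : hom A A :=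
  @Hom S A A (fun a => a) (fun o a => erefl).

Lemma hom_comp_subproof (S : signature) (A B C : algebra S)
  (g : hom B C) (f : hom A B) : is_hom (fun a => g (f a)).
Proof. by move=> o a; rewrite !hom_fun_is_hom. Qed.

Definition hom_comp (S : signature) (A B C : algebra S)
  (g : hom B C) (f : hom A B) : hom A C := Hom (hom_comp_subproof g f).

Definition isomorphic (S : signature) (A B : algebra S) : Prop :=
  exists f : hom A B, bijective f.

Inductive term (S : signature) (V : Type) : Type :=
| Var of V
| App (o : symbol S) of ('I_(arity o) -> term S V).
Arguments Var {S V} _.
Arguments App {S V} o _.

Definition term_algebra (S : signature) (V : Type) : algebra S :=
  @Algebra S (term S V) (@App S V).

Fixpoint eval (S : signature) (V : Type) (A : algebra S) (v : V -> A)
    (t : term S V) : A :=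
  match t with
  | Var x => v x
  | App o ts => op o (fun i => eval v (ts i))
  end.

Definition holds (S : signature) (V : Type) (A : algebra S)
    (e : term S V * term S V) : Prop :=
  forall v : V -> A, eval v e.1 = eval v e.2.

Definition is_variety (S : signature) (Theta : algebra S -> Prop) : Prop :=
  exists E : set (term S nat * term S nat),
    forall A, Theta A <-> forall e, E e -> holds A e.

Record congruence (S : signature) (A : algebra S) := Congruence {
  congr_rel : set (A * A);
  congr_refl : forall a, congr_rel (a, a);
  congr_sym : forall a b, congr_rel (a, b) -> congr_rel (b, a);
  congr_trans : forall a b c,
    congr_rel (a, b) -> congr_rel (b, c) -> congr_rel (a, c);
  congr_op : forall (o : symbol S) (a b : 'I_(arity o) -> A),
    (forall i, congr_rel (a i, b i)) -> congr_rel (op o a, op o b) }.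

Definition class_of (S : signature) (A : algebra S) (R : congruence A) (a : A) :
  set A := [set b | congr_rel R (a, b)].

Definition quot_carrier (S : signature) (A : algebra S) (R : congruence A) :
  Type := {C : set A | exists a, C = class_of R a}.

Definition to_class (S : signature) (A : algebra S) (R : congruence A) (a : A) :
  quot_carrier R := exist _ (class_of R a) (ex_intro _ a erefl).

Definition rep (S : signature) (A : algebra S) (R : congruence A)
  (C : quot_carrier R) : A := projT1 (cid (proj2_sig C)).

Definition quotient (S : signature) (A : algebra S) (R : congruence A) :
    algebra S :=
  @Algebra S (quot_carrier R)
    (fun o Cs => to_class R (op o (fun i => rep (Cs i)))).

Lemma repK (S : signature) (A : algebra S) (R : congruence A)
  (C : quot_carrier R) : to_class R (rep C) = C.
Proof.
case: C => C hC; rewrite /rep /=; case: (cid _) => a /= e.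
by apply: eq_exist; rewrite /= e.
Qed.

Lemma to_classP (S : signature) (A : algebra S) (R : congruence A) (a b : A) :
  to_class R a = to_class R b <-> congr_rel R (a, b).
Proof.
split=> [[e]|Rab].
  have: class_of R b b by exact: congr_refl.
  by rewrite -e.
apply: eq_exist; apply/seteqP; split=> c /= h.
  exact: congr_trans (congr_sym Rab) h.
exact: congr_trans Rab h.
Qed.

Lemma rep_class (S : signature) (A : algebra S) (R : congruence A) (a : A) :
  congr_rel R (rep (to_class R a), a).
Proof. by apply/to_classP; rewrite repK. Qed.

Lemma to_class_is_hom (S : signature) (A : algebra S) (R : congruence A) :
  @is_hom S A (quotient R) (to_class R).
Proof.
move=> o a; apply/to_classP; apply: congr_op => i.
by apply: congr_sym; exact: rep_class.
Qed.

Definition natural (S : signature) (A : algebra S) (R : congruence A) :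
  hom A (quotient R) := Hom (@to_class_is_hom S A R).

Lemma classes_inj (S : signature) (A : algebra S) (R R' : congruence A) :
  [set C | exists a, C = class_of R a] = [set C | exists a, C = class_of R' a] ->
  congr_rel R = congr_rel R'.
Proof.
have sub (Q Q' : congruence A) :
    [set C | exists a, C = class_of Q a] `<=` [set C | exists a, C = class_of Q' a] ->
    congr_rel Q `<=` congr_rel Q'.
  move=> h [a b] Qab; have [|c e] := h (class_of Q a); first by exists a.
  have Qa : class_of Q' c a by rewrite -e; exact: congr_refl.
  have Qb : class_of Q' c b by rewrite -e.
  exact: congr_trans (congr_sym Qa) Qb.
by move=> e; apply/seteqP; split; apply: sub; rewrite e.
Qed.

Definition valid_pairs (S : signature) (Theta : algebra S -> Prop) (V : Type) :
    set (term_algebra S V * term_algebra S V) :=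
  [set e | forall A, Theta A -> holds A e].

Lemma valid_op (S : signature) (Theta : algebra S -> Prop) (V : Type)
  (o : symbol S) (a b : 'I_(arity o) -> term_algebra S V) :
  (forall i, valid_pairs Theta (a i, b i)) ->
  valid_pairs Theta (op o a, op o b).
Proof.
move=> h A hA v /=; congr (op o _); apply/funext => i; exact: (h i A hA v).
Qed.

Definition valid_congr (S : signature) (Theta : algebra S -> Prop) (V : Type) :
  congruence (term_algebra S V).
Proof.
apply: (@Congruence S (term_algebra S V) (@valid_pairs S Theta V)).
- by move=> a A hA v.
- by move=> a b h A hA v; rewrite (h A hA v).
- by move=> a b c h h' A hA v; rewrite (h A hA v) -(h' A hA v).
- exact: valid_op.
Defined.

Definition free_algebra (S : signature) (Theta : algebra S -> Prop) (V : Type) :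
  algebra S := quotient (valid_congr Theta V).

Definition free_gen (S : signature) (Theta : algebra S -> Prop) (V : Type)
  (x : V) : free_algebra Theta V := to_class (valid_congr Theta V) (Var x).

Lemma eval_hom (S : signature) (V : Type) (A B : algebra S) (f : hom A B)
  (v : V -> A) (t : term S V) : f (eval v t) = eval (fun x => f (v x)) t.
Proof.
elim: t => [x|o ts IH] //=; rewrite hom_fun_is_hom.
by congr (op o _); apply/funext.
Qed.

Lemma eval_is_hom (S : signature) (V : Type) (A : algebra S) (v : V -> A) :
  @is_hom S (term_algebra S V) A (eval v).
Proof. by []. Qed.

Lemma eval_Var (S : signature) (Theta : algebra S -> Prop) (V : Type)
  (t : term S V) :
  eval (@free_gen S Theta V) t = to_class (valid_congr Theta V) t.
Proof.
elim: t => [x|o ts IH] //=.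
rewrite -[RHS]/(natural _ (@op S (term_algebra S V) o ts)) hom_fun_is_hom.
by congr (@op S (free_algebra Theta V) o _); apply/funext.
Qed.

Theorem free_algebra_in (S : signature) (Theta : algebra S -> Prop) (V : Type) :
  is_variety Theta -> Theta (free_algebra Theta V).
Proof.
move=> [E ThetaE]; apply/ThetaE => e Ee v.
pose w n : term_algebra S V := rep (v n).
have -> : v = fun n => natural (valid_congr Theta V) (w n).
  by apply/funext => n /=; rewrite repK.
rewrite -!eval_hom; apply/to_classP => A hA u.
have /ThetaE /(_ e Ee (fun n => eval u (w n))) := hA.
by rewrite -!(eval_hom (Hom (eval_is_hom u))).
Qed.

Theorem free_algebra_universal (S : signature) (Theta : algebra S -> Prop)
  (V : Type) (A : algebra S) (v : V -> A) :
  Theta A ->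
  exists! f : hom (free_algebra Theta V) A, forall x, f (free_gen Theta x) = v x.
Proof.
move=> hA; pose R := valid_congr Theta V.
have fE t : eval v (rep (to_class R t)) = eval v t by exact: (rep_class R t A hA v).
have fhom : @is_hom S (free_algebra Theta V) A (fun C => eval v (rep C)).
  by move=> o Cs; rewrite /= fE.
exists (Hom fhom); split=> [x|g gv]; first by rewrite /= fE.
apply: hom_eq => C; rewrite -(repK C) /= fE -eval_Var eval_hom.
by congr (eval _ _); apply/funext => x; rewrite gv.
Qed.

Definition ker (S : signature) (A B : algebra S) (f : hom A B) : set (A * A) :=
  [set p | f p.1 = f p.2].

(* The relation T''_H. *)
Definition closure_wrt (S : signature) (H A : algebra S) (T : set (A * A)) :
    set (A * A) :=
  \bigcap_(f in [set f : hom A H | T `<=` ker f]) ker f.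

Record closed_rel (S : signature) (H A : algebra S) := ClosedRel {
  closed_set :> set (A * A);
  closed_setP : closed_set = closure_wrt H closed_set }.

Lemma closed_relP (S : signature) (H A : algebra S) (T : closed_rel H A)
  (p : A * A) :
  closed_set T p <-> forall f : hom A H, closed_set T `<=` ker f -> ker f p.
Proof. by rewrite {1}closed_setP; split=> h f; exact: h. Qed.

Definition closed_congr (S : signature) (H A : algebra S)
  (T : closed_rel H A) : congruence A.
Proof.
apply: (@Congruence S A (closed_set T)).
- by move=> a; apply/closed_relP.
- move=> a b /closed_relP h; apply/closed_relP => f /h; exact: esym.
- move=> a b c /closed_relP h /closed_relP h'; apply/closed_relP => f hf.
  exact: etrans (h f hf) (h' f hf).
- move=> o a b h; apply/closed_relP => f hf; rewrite /ker /= !hom_fun_is_hom.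
  by congr (op o _); apply/funext => i; exact: (hf _ (h i)).
Defined.

Record category := Category {
  ob : Type;
  mor : ob -> ob -> Type;
  idm : forall X, mor X X;
  compm : forall X Y Z, mor Y Z -> mor X Y -> mor X Z;
  compm1 : forall X Y (f : mor X Y), compm f (idm X) = f;
  comp1m : forall X Y (f : mor X Y), compm (idm Y) f = f;
  compmA : forall X Y Z W (h : mor Z W) (g : mor Y Z) (f : mor X Y),
    compm h (compm g f) = compm (compm h g) f }.
Arguments idm {c} X.
Arguments compm {c X Y Z} _ _.

Record functor (C D : category) := Functor {
  fob :> ob C -> ob D;
  fmor : forall X Y, mor X Y -> mor (fob X) (fob Y);
  fmor_id : forall X, fmor (idm X) = idm (fob X);
  fmor_comp : forall X Y Z (g : mor Y Z) (f : mor X Y),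
    fmor (compm g f) = compm (fmor g) (fmor f) }.
Arguments fmor {C D} _ {X Y} _.

Definition functor_id (C : category) : functor C C :=
  @Functor C C (fun X => X) (fun X Y f => f) (fun X => erefl)
    (fun X Y Z g f => erefl).

Definition functor_comp (C D E : category) (G : functor D E) (F : functor C D) :
  functor C E.
Proof.
apply: (@Functor C E (fun X => G (F X)) (fun X Y f => fmor G (fmor F f))).
- by move=> X; rewrite !fmor_id.
- by move=> X Y Z g f; rewrite !fmor_comp.
Defined.

Definition is_cat_iso (C D : category) (F : functor C D) : Prop :=
  exists G : functor D C,
    functor_comp G F = functor_id C /\ functor_comp F G = functor_id D.

Section Categories.
Variables (S : signature) (X0 : countType) (Theta : algebra S -> Prop).

Definition F (X : {fset X0}) : algebra S := free_algebra Theta X.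

(* An object F(X) is represented by the set X of its free generators. *)
Definition Theta0 : category.
Proof.
apply: (@Category {fset X0} (fun X Y => hom (F X) (F Y)) (fun X => hom_id (F X))
  (fun X Y Z g f => hom_comp g f)).
all: by move=> *; apply: hom_eq.
Defined.

Variable H : algebra S.

Definition Cl_ob : Type := {X : {fset X0} & closed_rel H (F X)}.

Definition pair_image (A B : algebra S) (f : A -> B) (T : set (A * A)) :
  set (B * B) := [set (f p.1, f p.2) | p in T].

Record Cl_mor (P Q : Cl_ob) := ClMor {
  Cl_hom :> hom (F (tag P)) (F (tag Q));
  Cl_homP : pair_image Cl_hom (tagged P) `<=` tagged Q }.

Lemma Cl_mor_eq (P Q : Cl_ob) (f g : Cl_mor P Q) :
  Cl_hom f = Cl_hom g -> f = g.
Proof.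
case: f g => [f hf] [g hg] /= e.
by move: hf hg; rewrite e => hf hg; congr ClMor; exact: Prop_irrelevance.
Qed.

Lemma Cl_id_subproof (P : Cl_ob) :
  pair_image (hom_id (F (tag P))) (tagged P) `<=` tagged P.
Proof. by move=> _ [[a b] h <-]. Qed.

Lemma Cl_comp_subproof (P Q R : Cl_ob) (g : Cl_mor Q R) (f : Cl_mor P Q) :
  pair_image (hom_comp g f) (tagged P) `<=` tagged R.
Proof.
move=> _ [p hp <-]; apply: (Cl_homP (c := g)); exists (f p.1, f p.2) => //.
by apply: (Cl_homP (c := f)); exists p.
Qed.

Definition Cl_id (P : Cl_ob) : Cl_mor P P := ClMor (@Cl_id_subproof P).

Definition Cl_comp (P Q R : Cl_ob) (g : Cl_mor Q R) (f : Cl_mor P Q) :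
  Cl_mor P R := ClMor (@Cl_comp_subproof P Q R g f).

Definition Cl : category.
Proof.
apply: (@Category Cl_ob Cl_mor Cl_id Cl_comp).
all: by move=> *; apply: Cl_mor_eq; apply: hom_eq.
Defined.

Definition Cl_quotient (P : Cl_ob) : algebra S :=
  quotient (closed_congr (tagged P)).

Definition tau (P : Cl_ob) : hom (F (tag P)) (Cl_quotient P) :=
  natural (closed_congr (tagged P)).

(* The elements of F(X)/T are the T-classes, so the algebra F(X)/T determines
   F(X) and T (see classes_inj); the object F(X)/T is therefore represented by (X, T).  Equality
   of these pairs is used for equality of objects since equality of carriers in
   Type would be uninformative. *)
Definition Cor : category.
Proof.
apply: (@Category Cl_ob (fun P Q => hom (Cl_quotient P) (Cl_quotient Q))
  (fun P => hom_id (Cl_quotient P)) (fun P Q R g f => hom_comp g f)).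
all: by move=> *; apply: hom_eq.
Defined.

Definition FG : functor Cl Theta0 :=
  @Functor Cl Theta0 (fun P => tag P) (fun P Q f => Cl_hom f)
    (fun P => erefl) (fun P Q R g f => erefl).

Lemma FR_fun_class (P Q : Cl_ob) (mu : Cl_mor P Q) (a : F (tag P)) :
  tau Q (mu (rep (tau P a))) = tau Q (mu a).
Proof.
apply/to_classP; apply: (Cl_homP (c := mu)).
by exists (rep (tau P a), a) => //; exact: (rep_class (closed_congr (tagged P))).
Qed.

Lemma FR_mor_subproof (P Q : Cl_ob) (mu : Cl_mor P Q) :
  @is_hom S (Cl_quotient P) (Cl_quotient Q) (fun C => tau Q (mu (rep C))).
Proof.
move=> o Cs; have e := FR_fun_class mu (op o (fun i => rep (Cs i))).
by apply: etrans e _; rewrite !hom_fun_is_hom.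
Qed.

Definition FR_mor (P Q : Cl_ob) (mu : Cl_mor P Q) :
  hom (Cl_quotient P) (Cl_quotient Q) := Hom (FR_mor_subproof mu).

Lemma FR_morE (P Q : Cl_ob) (mu : Cl_mor P Q) :
  hom_comp (FR_mor mu) (tau P) = hom_comp (tau Q) mu.
Proof. by apply: hom_eq => a; exact: FR_fun_class. Qed.

Lemma FR_mor_unique (P Q : Cl_ob) (mu : Cl_mor P Q)
  (f : hom (Cl_quotient P) (Cl_quotient Q)) :
  hom_comp f (tau P) = hom_comp (tau Q) mu -> f = FR_mor mu.
Proof.
rewrite -FR_morE => e; apply: hom_eq => C.
by rewrite -(repK C) -[LHS]/(hom_comp f (tau P) (rep C)) e.
Qed.

Definition FR : functor Cl Cor.
Proof.
apply: (@Functor Cl Cor (fun P => P) (fun P Q mu => FR_mor mu)).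
- by move=> P; apply/esym/FR_mor_unique; apply: hom_eq.
- move=> P Q R g f; apply/esym/FR_mor_unique; apply: hom_eq => a.
  have e := FR_fun_class f a; rewrite /= in e *; rewrite e.
  exact: (FR_fun_class g (f a)).
Defined.

End Categories.

(* Main.v *)
Require Import Defs.
From mathcomp Require Import all_boot finmap.
From mathcomp Require Import boolp classical_sets functions cardinality.

(* An isomorphism of categories is a functor bijective on objects and on each
   set of morphisms, so everything reduces to comparing [Lam], [Phi] and [Psi]
   on morphisms.

   (New) => (Old): every homomorphism F(X1) -> F(X2) is a morphism from
   (F(X1), T0) to (F(X2), T), where T0 is the least closed relation, and
   FR identifies two such morphisms iff they agree modulo T; as Psi is
   faithful, this is transported by Lam.

   (Old) => (New): put Lam(F(X), T) = (Phi F(X), alpha T) and Lam(mu) = Phi(mu).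
   As Phi F(x1) is free on one generator, a pair in alpha T is a pair of
   homomorphisms Phi F(x1) -> Phi F(X), i.e. the image under Phi of a pair
   F(x1) -> F(X); hence mu maps T1 into T2 iff Phi(mu) maps alpha T1 into
   alpha T2, and Lam is fully faithful.  Since FR is full (free algebras are
   projective), Lam descends to Psi. *)

Local Open Scope classical_set_scope.

Set Implicit Arguments.
Unset Strict Implicit.
Unset Printing Implicit Defensive.

(** * Morphisms whose endpoints are only propositionally equal *)

Section Arrows.
Variables C D : category.

(* Packing a morphism with its endpoints makes morphisms with propositionally
   equal endpoints comparable. *)
Definition arrow (C : category) (X Y : ob C) (f : mor X Y) :
    {p : ob C * ob C & mor p.1 p.2} :=
  existT (fun p : ob C * ob C => mor p.1 p.2) (X, Y) f.

(** Proof irrelevance turns the equality of endpoints into [erefl], so no transport remains. *)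
Lemma arrow_inj (X Y : ob C) : injective (@arrow C X Y).
Proof.
move=> f g e; have := projT2_eq e.
by rewrite (Prop_irrelevance (projT1_eq e) erefl).
Qed.

Lemma arrow_ends (X Y X' Y' : ob C) (f : mor X Y) (g : mor X' Y') :
  arrow f = arrow g -> X = X' /\ Y = Y'.
Proof. by move=> /projT1_eq /= [-> ->]. Qed.

Lemma arrow_cast (X Y X' Y' : ob C) (f : mor X Y) :
  X = X' -> Y = Y' -> exists g : mor X' Y', arrow g = arrow f.
Proof. by case: X' /; case: Y' /; exists f. Qed.

Lemma arrow_comp (X Y Z X' Y' Z' : ob C) (f : mor X Y) (g : mor Y Z)
    (f' : mor X' Y') (g' : mor Y' Z') :
  arrow f = arrow f' -> arrow g = arrow g' ->
  arrow (compm g f) = arrow (compm g' f').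
Proof.
move=> ef eg; have [eX eY] := arrow_ends ef; have [_ eZ] := arrow_ends eg.
case: X' / eX f' ef; case: Y' / eY g' eg; case: Z' / eZ.
by move=> g' /arrow_inj -> f' /arrow_inj ->.
Qed.

(** Carries an equation between parallel morphisms across an equality of functors, where endpoints
    need not match by conversion. *)
Lemma arrow_eq (X Y X' Y' : ob C) (f g : mor X Y) (f' g' : mor X' Y') :
  arrow f = arrow f' -> arrow g = arrow g' -> f = g <-> f' = g'.
Proof.
move=> ef eg; have [eX eY] := arrow_ends ef.
case: X' / eX f' g' ef eg; case: Y' / eY.
by move=> f' g' /arrow_inj -> /arrow_inj ->.
Qed.

Lemma arrow_fmor (Fu : functor C D) (X Y X' Y' : ob C) (f : mor X Y)
    (f' : mor X' Y') :
  arrow f = arrow f' -> arrow (fmor Fu f) = arrow (fmor Fu f').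
Proof.
move=> ef; have [eX eY] := arrow_ends ef.
by case: X' / eX f' ef; case: Y' / eY => f' /arrow_inj ->.
Qed.

End Arrows.

(** * Equality of functors and isomorphisms of categories *)

Lemma functor_ext (C D : category) (F1 F2 : functor C D) :
  (forall (X Y : ob C) (f : mor X Y), arrow (fmor F1 f) = arrow (fmor F2 f)) ->
  F1 = F2.
Proof.
case: F1 F2 => [o1 m1 i1 c1] [o2 m2 i2 c2] /= h.
(* The arrow of an image of an identity records the value on objects. *)
have e : o1 = o2 by apply/funext => X; have [] := arrow_ends (h X X (idm X)).
case: o2 / e m2 i2 c2 h => m2 i2 c2 h.
have e : m1 = m2.
  apply: functional_extensionality_dep => X.
  apply: functional_extensionality_dep => Y.
  by apply/funext => f; apply: arrow_inj.
by case: m2 / e i2 c2 {h} => i2 c2; congr Functor; exact: Prop_irrelevance.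
Qed.

Lemma arrow_functor (C D : category) (F1 F2 : functor C D) (X Y : ob C)
  (f : mor X Y) : F1 = F2 -> arrow (fmor F1 f) = arrow (fmor F2 f).
Proof. by move=> ->. Qed.

Lemma is_cat_iso_bij (C D : category) (Fu : functor C D) :
  is_cat_iso Fu ->
  bijective (fob Fu) /\ forall X Y, bijective (@fmor _ _ Fu X Y).
Proof.
move=> [Gu [GF FG]].
have gf X Y (f : mor X Y) : arrow (fmor Gu (fmor Fu f)) = arrow f.
  exact: (arrow_functor f GF).
have fg X Y (f : mor X Y) : arrow (fmor Fu (fmor Gu f)) = arrow f.
  exact: (arrow_functor f FG).
have gK X : Gu (Fu X) = X by have [] := arrow_ends (gf _ _ (idm X)).
have fK X : Fu (Gu X) = X by have [] := arrow_ends (fg _ _ (idm X)).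
split; first by exists (fob Gu).
(* [fmor Gu h] runs from [Gu (Fu X)] to [Gu (Fu Y)] and has to be recast between [X] and [Y]. *)
move=> X Y; have ex (h : mor (Fu X) (Fu Y)) : exists f, fmor Fu f = h.
  have [f ef] := arrow_cast (fmor Gu h) (gK X) (gK Y).
  by exists f; apply: arrow_inj; rewrite (arrow_fmor Fu ef) fg.
exists (fun h => projT1 (cid (ex h))) => [f|h]; last by case: (cid _).
case: (cid _) => f' /= e; apply: arrow_inj.
by rewrite -gf e gf.
Qed.

Lemma bij_is_cat_iso (C D : category) (Fu : functor C D) :
  bijective (fob Fu) ->
  (forall X Y, injective (@fmor _ _ Fu X Y)) ->
  (forall X Y (h : mor (Fu X) (Fu Y)), exists f, fmor Fu f = h) ->
  is_cat_iso Fu.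
Proof.
move=> [g gK fK] finj fsurj.
have ainj X Y X' Y' (f : mor X Y) (f' : mor X' Y') :
    arrow (fmor Fu f) = arrow (fmor Fu f') -> arrow f = arrow f'.
  move=> e; have [/(can_inj gK) eX /(can_inj gK) eY] := arrow_ends e.
  by case: X' / eX f' e; case: Y' / eY => f' /arrow_inj/finj ->.
have ex X Y (h : mor X Y) : exists f : mor (g X) (g Y), arrow (fmor Fu f) = arrow h.
  have [h' <-] := arrow_cast h (esym (fK X)) (esym (fK Y)).
  by have [f <-] := fsurj _ _ h'; exists f.
pose gm X Y (h : mor X Y) := projT1 (cid (ex X Y h)).
have gmE X Y (h : mor X Y) : arrow (fmor Fu (gm X Y h)) = arrow h.
  exact: projT2 (cid (ex X Y h)).
(* Faithfulness of [Fu] reduces the functor laws of the inverse to those of [Fu]. *)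
have gm1 X : gm X X (idm X) = idm (g X).
  by apply/finj/arrow_inj; rewrite gmE fmor_id fK.
have gmM X Y Z (b : mor Y Z) (a : mor X Y) :
    gm X Z (compm b a) = compm (gm Y Z b) (gm X Y a).
  by apply/finj/arrow_inj; rewrite gmE fmor_comp; apply: arrow_comp; rewrite gmE.
exists (Functor gm1 gmM); split; apply: functor_ext => X Y f /=; last exact: gmE.
by apply: ainj; rewrite gmE.
Qed.

(** * Closed relations, and fullness of the quotient functor *)

Section ClosedRelations.
Variables (S : signature) (X0 : countType) (Theta : algebra S -> Prop).

(** Every element is a term in the generators. [B] is arbitrary, so quotients qualify without a
    check that they lie in [Theta]. *)
Lemma free_hom_ext (V : Type) (B : algebra S)
    (f g : hom (free_algebra Theta V) B) :
  (forall x, f (free_gen Theta x) = g (free_gen Theta x)) -> f = g.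
Proof.
move=> e; apply: hom_eq => a; rewrite -(repK a) -eval_Var !eval_hom.
by congr (eval _ _); apply/funext.
Qed.

Lemma natural_comp_eq (A B : algebra S) (R : congruence B) (f g : hom A B) :
  hom_comp (natural R) f = hom_comp (natural R) g <->
  forall a, congr_rel R (f a, g a).
Proof.
split=> [e a|h]; last by apply: hom_eq => a; apply/to_classP/h.
by apply/to_classP; rewrite -[LHS]/(hom_comp (natural R) f a) e.
Qed.

Lemma min_closed_subproof (H A : algebra S) :
  closure_wrt H (@set0 (A * A)) = closure_wrt H (closure_wrt H set0).
Proof.
apply/seteqP; split=> p h f hf; last by apply: h => q /(_ f); apply => ? [].
exact: hf.
Qed.

(** This is the common kernel of all homomorphisms from [A] to [H]. *)
Definition min_closed (H A : algebra S) : closed_rel H A :=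
  ClosedRel (min_closed_subproof H A).

(** A test map [g : B -> H] composed with [f] is a homomorphism [A -> H], so its kernel contains the
    least closed relation. *)
Lemma min_closed_hom (H A B : algebra S) (T : closed_rel H B) (f : hom A B) :
  pair_image f (min_closed H A) `<=` T.
Proof.
move=> _ [p hp <-]; apply/closed_relP => g _.
by apply: (hp (hom_comp g f)).
Qed.

Lemma FR_mor_eq (H : algebra S) (P Q : Cl_ob X0 Theta H) (f g : Cl_mor P Q) :
  FR_mor f = FR_mor g <-> hom_comp (tau Q) f = hom_comp (tau Q) g.
Proof.
split=> [e|e]; first by rewrite -!FR_morE e.
by apply: FR_mor_unique; rewrite FR_morE.
Qed.

Lemma FR_full (H : algebra S) (P Q : Cl_ob X0 Theta H)
    (f : hom (Cl_quotient P) (Cl_quotient Q)) :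
  is_variety Theta -> exists mu : Cl_mor P Q, FR_mor mu = f.
Proof.
move=> Theta_variety.
have FQ : Theta (F Theta (tag Q)) by exact: free_algebra_in.
(* Projectivity: each generator goes to a representative of the class that [f] assigns to it. *)
pose v x : F Theta (tag Q) := rep (f (tau P (free_gen Theta x))).
have [m [mv _]] := free_algebra_universal v FQ.
have e : hom_comp f (tau P) = hom_comp (tau Q) m.
  by apply: free_hom_ext => x /=; rewrite mv repK.
have mP : pair_image m (tagged P) `<=` tagged Q.
  move=> _ [[a b] hab <-] /=; apply/(to_classP (closed_congr (tagged Q))).
  have ea c : to_class (closed_congr (tagged Q)) (m c) = f (tau P c).
    by rewrite -[LHS]/(hom_comp (tau Q) m c) -e.
  by rewrite !ea; congr (f _); apply/to_classP.
by exists (ClMor mP); apply/esym/FR_mor_unique.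
Qed.

End ClosedRelations.

(** * From isomorphisms of the three categories to the bijections [alpha] *)

Section NewToOld.
Variables (S : signature) (X0 : countType) (Theta : algebra S -> Prop).
Variables (H1 H2 : algebra S).
Variables (Lam : functor (Cl X0 Theta H1) (Cl X0 Theta H2))
          (Phi : functor (Theta0 X0 Theta) (Theta0 X0 Theta))
          (Psi : functor (Cor X0 Theta H1) (Cor X0 Theta H2)).
Hypotheses (Lam_iso : is_cat_iso Lam) (Phi_iso : is_cat_iso Phi)
  (Psi_iso : is_cat_iso Psi)
  (FG_Lam : functor_comp (FG X0 Theta H2) Lam =
            functor_comp Phi (FG X0 Theta H1))
  (FR_Lam : functor_comp (FR X0 Theta H2) Lam =
            functor_comp Psi (FR X0 Theta H1)).

Local Notation pair H X T :=
  (existT (fun Z : {fset X0} => closed_rel H (F Theta Z)) X T).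

(** On identities, [FG_Lam] says that [Lam] lies over [Phi] on objects; [alpha] is then the second
    component of [Lam]. *)
Let lam_alpha (X : {fset X0}) (T : closed_rel H1 (F Theta X)) :
  exists T' : closed_rel H2 (F Theta (Phi X)), Lam (pair H1 X T) = pair H2 (Phi X) T'.
Proof.
have := arrow_ends (arrow_functor (idm (pair H1 X T : ob (Cl X0 Theta H1))) FG_Lam).
by move=> [/= <- _]; exists (tagged (Lam (pair H1 X T))); case: (Lam _).
Qed.

Let alpha X T := projT1 (cid (@lam_alpha X T)).

Let alphaE X T : Lam (pair H1 X T) = pair H2 (Phi X) (alpha T).
Proof. exact: projT2 (cid (@lam_alpha X T)). Qed.

Let pair_inj H X : injective (fun T => pair H X T).
Proof.
move=> T T' e; have := projT2_eq e.
by rewrite (Prop_irrelevance (projT1_eq e) erefl).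
Qed.

Let alpha_bij X : bijective (@alpha X).
Proof.
have [[g gK Kg] _] := is_cat_iso_bij Lam_iso.
have [/bij_inj Phi_inj _] := is_cat_iso_bij Phi_iso.
(* The preimage of [(Phi X, T')] under [Lam] is some [(Y, T)] with [Phi Y = Phi X]; injectivity of
   [Phi] on objects gives [Y = X]. *)
have ex (T' : closed_rel H2 (F Theta (Phi X))) : exists T, alpha T = T'.
  case: (g (pair H2 (Phi X) T')) (Kg (pair H2 (Phi X) T')) => Y T.
  rewrite alphaE => e; have /Phi_inj eX := projT1_eq e.
  by case: X / eX T' e => T' /pair_inj <-; exists T.
exists (fun T' => projT1 (cid (ex T'))) => [T|T']; last by case: (cid _).
case: (cid _) => T0 /= e; apply: pair_inj; apply: (can_inj gK).
by rewrite !alphaE e.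
Qed.

(** [Q1] and [Q2] are kept as variables so that the equalities [alphaE] can be substituted for
    them. *)
Let natural_cast (Q1 Q2 : Cl_ob X0 Theta H2) (n1 n2 : Cl_mor Q1 Q2)
    (Y1 Y2 : ob (Theta0 X0 Theta)) (T1 : closed_rel H2 (F Theta Y1))
    (T2 : closed_rel H2 (F Theta Y2)) (p1 p2 : mor Y1 Y2) :
  Q1 = pair H2 Y1 T1 -> Q2 = pair H2 Y2 T2 ->
  arrow (Cl_hom n1 : @mor (Theta0 X0 Theta) _ _) = arrow p1 ->
  arrow (Cl_hom n2 : @mor (Theta0 X0 Theta) _ _) = arrow p2 ->
  hom_comp (tau Q2) n1 = hom_comp (tau Q2) n2 <->
  hom_comp (natural (closed_congr T2)) p1 =
    hom_comp (natural (closed_congr T2)) p2.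
Proof.
move=> e1 e2; move: n1 n2; rewrite e1 e2 => n1 n2.
by move=> /arrow_inj <- /arrow_inj <-.
Qed.

Lemma new_to_old :
  exists alpha : forall X : {fset X0},
      closed_rel H1 (F Theta X) -> closed_rel H2 (F Theta (Phi X)),
    (forall X, bijective (alpha X)) /\
    forall (X1 X2 : {fset X0}) (mu1 mu2 : hom (F Theta X1) (F Theta X2))
           (T : closed_rel H1 (F Theta X2)),
      hom_comp (natural (closed_congr T)) mu1 =
        hom_comp (natural (closed_congr T)) mu2
      <->
      hom_comp (natural (closed_congr (alpha X2 T)))
          (@fmor _ _ Phi X1 X2 mu1) =
        hom_comp (natural (closed_congr (alpha X2 T)))
          (@fmor _ _ Phi X1 X2 mu2).
Proof.
exists alpha; split=> // X1 X2 mu1 mu2 T.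
pose P1 : ob (Cl X0 Theta H1) := pair H1 X1 (min_closed H1 (F Theta X1)).
pose P2 : ob (Cl X0 Theta H1) := pair H1 X2 T.
pose lift (mu : hom (F Theta X1) (F Theta X2)) : @mor (Cl X0 Theta H1) P1 P2 :=
  @ClMor S X0 Theta H1 P1 P2 mu (@min_closed_hom _ _ _ _ T mu).
have Psi_inj : injective (@fmor _ _ Psi P1 P2).
  by have [_ /(_ P1 P2) /bij_inj] := is_cat_iso_bij Psi_iso.
(* The equation for [Phi] modulo [alpha T] becomes one between the images under [Lam] of the two
   lifts. *)
rewrite -(natural_cast (alphaE _) (alphaE _)
  (arrow_functor (lift mu1) FG_Lam) (arrow_functor (lift mu2) FG_Lam)).
rewrite -FR_mor_eq.
rewrite (arrow_eq (arrow_functor (lift mu1) FR_Lam)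
                  (arrow_functor (lift mu2) FR_Lam)) /=.
split=> [e|/Psi_inj]; last by move/FR_mor_eq.
by congr (fmor Psi _); apply/FR_mor_eq.
Qed.

End NewToOld.

(** * From the bijections [alpha] to isomorphisms of the three categories *)

Section OldToNew.
Variables (S : signature) (X0 : countType) (x1 : X0).
Variables (Theta : algebra S -> Prop) (H1 H2 : algebra S).
Hypothesis Theta_variety : is_variety Theta.
Variable Phi : functor (Theta0 X0 Theta) (Theta0 X0 Theta).
Hypothesis Phi_iso : is_cat_iso Phi.
Hypothesis Phi_x1 :
  isomorphic (F Theta (Phi [fset x1]%fset)) (F Theta [fset x1]%fset).
Variable alpha : forall X : {fset X0},
  closed_rel H1 (F Theta X) -> closed_rel H2 (F Theta (Phi X)).
Hypothesis alpha_bij : forall X, bijective (@alpha X).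
Hypothesis alphaP : forall (X1 X2 : {fset X0})
    (mu1 mu2 : hom (F Theta X1) (F Theta X2)) (T : closed_rel H1 (F Theta X2)),
  hom_comp (natural (closed_congr T)) mu1 =
    hom_comp (natural (closed_congr T)) mu2
  <->
  hom_comp (natural (closed_congr (alpha T))) (@fmor _ _ Phi X1 X2 mu1) =
    hom_comp (natural (closed_congr (alpha T))) (@fmor _ _ Phi X1 X2 mu2).

Let Fx1 := F Theta [fset x1]%fset.
Let gen1 : Fx1 := free_gen Theta [` fset11 x1]%fset.

Let point (X : {fset X0}) (a : F Theta X) : exists m : hom Fx1 (F Theta X), m gen1 = a.
Proof.
have FX : Theta (F Theta X) by exact: free_algebra_in.
have [m [mv _]] := free_algebra_universal (fun _ : [fset x1]%fset => a) FX.
by exists m; exact: mv.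
Qed.

Let gen1_congr (X : {fset X0}) (R : congruence (F Theta X)) (f g : hom Fx1 (F Theta X)) :
  congr_rel R (f gen1, g gen1) -> forall a, congr_rel R (f a, g a).
Proof.
move=> h; apply/natural_comp_eq/free_hom_ext => x /=; apply/to_classP.
suff -> : x = [` fset11 x1]%fset by [].
by apply/val_inj/eqP; have := valP x; rewrite inE.
Qed.

(** Maps from [Fx1] that send the generator to [a] and [b] are composed with the isomorphism [iota]
    and lifted through the full functor [Phi]; [c] is the generator carried back along [iota]. *)
Let Phi_point (X : {fset X0}) (a b : F Theta (Phi X)) (R : congruence (F Theta (Phi X))) :
  congr_rel R (a, b) ->
  exists (u v : @mor (Theta0 X0 Theta) [fset x1]%fset X) c,
   [/\ fmor Phi u c = a, fmor Phi v c = b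
     & hom_comp (natural R) (fmor Phi u) = hom_comp (natural R) (fmor Phi v)].
Proof.
move=> Rab; have [iota [jota ji ij]] := Phi_x1.
have [_ /(_ [fset x1]%fset X) [inv _ invK]] := is_cat_iso_bij Phi_iso.
have [m ma] := point a; have [n nb] := point b.
exists (inv (hom_comp m iota)), (inv (hom_comp n iota)), (jota gen1).
rewrite !invK; split; rewrite /= ?ij //.
by apply/natural_comp_eq => c /=; apply: gen1_congr; rewrite ma nb.
Qed.

Local Notation pair H X T :=
  (existT (fun Z : {fset X0} => closed_rel H (F Theta Z)) X T).

Let Phi_homP (X Y : {fset X0}) (T : closed_rel H1 (F Theta X))
    (U : closed_rel H1 (F Theta Y)) (mu : @mor (Theta0 X0 Theta) X Y) :
  pair_image (mu : hom _ _) T `<=` U <->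
  pair_image (fmor Phi mu : hom _ _) (alpha T) `<=` alpha U.
Proof.
split=> h _ [[a b] hab <-] /=.
(* [alphaP] pulls the congruence of [Phi u] and [Phi v] back to [T]; there [mu] applies, and
   [alphaP] returns the result to [alpha U], read at [c]. *)
- have [u [v [c [<- <- /alphaP/natural_comp_eq uv]]]] :=
    @Phi_point X a b (closed_congr (alpha T)) hab.
  have /alphaP/natural_comp_eq/(_ c) :
      hom_comp (natural (closed_congr U)) (compm mu u) =
      hom_comp (natural (closed_congr U)) (compm mu v).
    by apply/natural_comp_eq => d; apply: h; exists (u d, v d) => //; exact: uv.
  by rewrite !fmor_comp.
(* Conversely, the pair is the value at [gen1] of two maps that are congruent modulo [T]. *)
- have [u ua] := point a; have [v vb] := point b.
  have /alphaP/natural_comp_eq uv :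
      hom_comp (natural (closed_congr T)) u = hom_comp (natural (closed_congr T)) v.
    by apply/natural_comp_eq/gen1_congr; rewrite ua vb.
  rewrite -ua -vb.
  suff /alphaP/natural_comp_eq/(_ gen1) :
      hom_comp (natural (closed_congr (alpha U)))
        (fmor Phi (compm mu (u : @mor (Theta0 X0 Theta) [fset x1]%fset X))) =
      hom_comp (natural (closed_congr (alpha U)))
        (fmor Phi (compm mu (v : @mor (Theta0 X0 Theta) [fset x1]%fset X))) by [].
  rewrite !fmor_comp; apply/natural_comp_eq => d.
  by apply: h; exists (fmor Phi u d, fmor Phi v d) => //; exact: uv.
Qed.

Let obj (P : Cl_ob X0 Theta H1) : Cl_ob X0 Theta H2 :=
  pair H2 (Phi (tag P)) (alpha (tagged P)).

Let obj_bij : bijective obj.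
Proof.
have [[g gK Kg] _] := is_cat_iso_bij Phi_iso.
have ex (Q : Cl_ob X0 Theta H2) : exists P, obj P = Q.
  (* Writing [Y] as [Phi (g Y)] gives [U] the type on which [alpha] can be inverted. *)
  case: Q => Y; rewrite -(Kg Y) => U.
  have [beta _ Kb] := alpha_bij (g Y).
  by exists (pair H1 (g Y) (beta U)); rewrite /obj /= Kb.
exists (fun Q => projT1 (cid (ex Q))) => [P|Q]; last by case: (cid _).
case: (cid _) => P' /= e; case: P P' e => [X T] [Y U] e.
have /(can_inj gK) /= eX := projT1_eq e.
case: X / eX T e => T e; have := projT2_eq e.
by rewrite (Prop_irrelevance (projT1_eq e) erefl) /= => /(bij_inj (alpha_bij Y)) ->.
Qed.

Let lam (P Q : Cl_ob X0 Theta H1) (mu : Cl_mor P Q) : Cl_mor (obj P) (obj Q) :=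
  @ClMor _ _ _ _ (obj P) (obj Q) (@fmor _ _ Phi (tag P) (tag Q) mu)
    (proj1 (Phi_homP (tagged P) (tagged Q) _) (Cl_homP (c := mu))).

Let Lam : functor (Cl X0 Theta H1) (Cl X0 Theta H2).
Proof.
apply: (@Functor (Cl X0 Theta H1) (Cl X0 Theta H2) obj lam).
- by move=> P; apply: Cl_mor_eq; apply: (fmor_id Phi (tag P)).
- move=> P Q R g f; apply: Cl_mor_eq.
  exact: (@fmor_comp _ _ Phi (tag P) (tag Q) (tag R) g f).
Defined.

Let lam_inj P Q : injective (@lam P Q).
Proof.
move=> f g /(congr1 (@Cl_hom _ _ _ _ _ _)) /= e; apply: Cl_mor_eq.
have [_ /(_ (tag P) (tag Q)) /bij_inj] := is_cat_iso_bij Phi_iso; exact.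
Qed.

(** The preimage under [Phi] respects the relations by the converse half of [Phi_homP]. *)
Let lam_surj P Q (h : Cl_mor (obj P) (obj Q)) : exists f, @lam P Q f = h.
Proof.
have [_ /(_ (tag P) (tag Q)) [inv _ invK]] := is_cat_iso_bij Phi_iso.
have hP : pair_image (inv h : hom _ _) (tagged P) `<=` tagged Q.
  by apply/Phi_homP; rewrite invK; exact: (Cl_homP (c := h)).
by exists (ClMor hP); apply: Cl_mor_eq; exact: invK.
Qed.

(** This is [alphaP] read through [FR]: one half makes [psi] independent of the chosen lift, the
    other makes it faithful. *)
Let FR_lam P Q (f g : Cl_mor P Q) :
  FR_mor (lam f) = FR_mor (lam g) <-> FR_mor f = FR_mor g.
Proof. by rewrite !FR_mor_eq; apply: iff_sym; exact: alphaP. Qed.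

Let lift (P Q : Cl_ob X0 Theta H1) (f : hom (Cl_quotient P) (Cl_quotient Q)) : Cl_mor P Q :=
  projT1 (cid (FR_full f Theta_variety)).

Let liftK (P Q : Cl_ob X0 Theta H1) (f : hom (Cl_quotient P) (Cl_quotient Q)) : FR_mor (lift f) = f.
Proof. exact: projT2 (cid (FR_full f Theta_variety)). Qed.

Let psi (P Q : Cl_ob X0 Theta H1) (f : hom (Cl_quotient P) (Cl_quotient Q)) :
  hom (Cl_quotient (obj P)) (Cl_quotient (obj Q)) := FR_mor (lam (lift f)).

Let psi_FR P Q (mu : Cl_mor P Q) : psi (FR_mor mu) = FR_mor (lam mu).
Proof. by apply/FR_lam; rewrite liftK. Qed.

Let Psi : functor (Cor X0 Theta H1) (Cor X0 Theta H2).
Proof.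
apply: (@Functor (Cor X0 Theta H1) (Cor X0 Theta H2) obj psi).
- move=> P; have <- := fmor_id (FR X0 Theta H1) P; rewrite /= psi_FR.
  by have /= -> := fmor_id Lam P; exact: (fmor_id (FR X0 Theta H2) (obj P)).
(* Both factors are written as images under [FR] of their lifts, so that [psi_FR] applies to the
   composite. *)
- move=> P Q R g f; rewrite /= -{1}(liftK g) -{1}(liftK f).
  have /= <- := fmor_comp (FR X0 Theta H1) (lift g) (lift f).
  rewrite psi_FR; have /= -> := fmor_comp Lam (lift g) (lift f).
  exact: (fmor_comp (FR X0 Theta H2) (lam (lift g)) (lam (lift f))).
Defined.

Lemma old_to_new :
  exists (Lam : functor (Cl X0 Theta H1) (Cl X0 Theta H2))
         (Phi : functor (Theta0 X0 Theta) (Theta0 X0 Theta))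
         (Psi : functor (Cor X0 Theta H1) (Cor X0 Theta H2)),
    [/\ is_cat_iso Lam, is_cat_iso Phi, is_cat_iso Psi,
        functor_comp (FG X0 Theta H2) Lam = functor_comp Phi (FG X0 Theta H1)
      & functor_comp (FR X0 Theta H2) Lam = functor_comp Psi (FR X0 Theta H1)].
Proof.
exists Lam, Phi, Psi; split=> //.
- exact: bij_is_cat_iso.
- apply: bij_is_cat_iso => // P Q => [f g /FR_lam|h]; first by rewrite !liftK.
  (* Fullness of [Psi]: a morphism is lifted first through [FR], then through [lam]. *)
  have [mu <-] := FR_full h Theta_variety; have [nu <-] := lam_surj mu.
  by exists (FR_mor nu); exact: psi_FR.
- exact: functor_ext.
- by apply: functor_ext => P Q mu; congr arrow; exact/esym/psi_FR.
Qed.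

End OldToNew.

Theorem theorem5p1 (S : signature) (X0 : countType) (x1 : X0)
  (Theta : algebra S -> Prop) (H1 H2 : algebra S)
  (X0_infinite : infinite_set [set: X0])
  (Theta_variety : is_variety Theta)
  (Theta_cond : forall Phi : functor (Theta0 X0 Theta) (Theta0 X0 Theta),
     is_cat_iso Phi ->
     isomorphic (F Theta (Phi [fset x1]%fset)) (F Theta [fset x1]%fset))
  (H1_in : Theta H1) (H2_in : Theta H2) :
  (exists (Lam : functor (Cl X0 Theta H1) (Cl X0 Theta H2))
          (Phi : functor (Theta0 X0 Theta) (Theta0 X0 Theta))
          (Psi : functor (Cor X0 Theta H1) (Cor X0 Theta H2)),
     [/\ is_cat_iso Lam, is_cat_iso Phi, is_cat_iso Psi,
         functor_comp (FG X0 Theta H2) Lam = functor_comp Phi (FG X0 Theta H1)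
       & functor_comp (FR X0 Theta H2) Lam = functor_comp Psi (FR X0 Theta H1)])
  <->
  (exists Phi : functor (Theta0 X0 Theta) (Theta0 X0 Theta),
     is_cat_iso Phi /\
     exists alpha : forall X : {fset X0},
         closed_rel H1 (F Theta X) -> closed_rel H2 (F Theta (Phi X)),
       (forall X, bijective (alpha X)) /\
       forall (X1 X2 : {fset X0}) (mu1 mu2 : hom (F Theta X1) (F Theta X2))
              (T : closed_rel H1 (F Theta X2)),
         hom_comp (natural (closed_congr T)) mu1 =
           hom_comp (natural (closed_congr T)) mu2
         <->
         hom_comp (natural (closed_congr (alpha X2 T)))
             (@fmor _ _ Phi X1 X2 mu1) =
           hom_comp (natural (closed_congr (alpha X2 T)))
             (@fmor _ _ Phi X1 X2 mu2)).
Proof.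
split=> [[Lam [Phi [Psi [Lam_iso Phi_iso Psi_iso FG_Lam FR_Lam]]]]|].
  exists Phi; split=> //; exact: (new_to_old Lam_iso Phi_iso Psi_iso FG_Lam FR_Lam).
move=> [Phi [Phi_iso [alpha [alpha_bij alphaP]]]].
exact: (old_to_new Theta_variety Phi_iso (Theta_cond Phi Phi_iso) alpha_bij alphaP).
Qed.
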